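(* Let $R$ be a finite Frobenius ring with generating character $\chi$, let $V=R^n$, and let $G$ be a finite permutation group acting on the coordinates of $V$. Let $H$ be a subgroup of $G$ such that $|H|$ has an inverse in $R$, let $t$ be the number of orbits of $H$ on the coordinates, and let $T\subseteq E:=\{1,\dots,t\}$. If $C$ is a left $G$-code of length $n$ over $R$, then $$\mathrm{CJ}^{H}_{((C^{\perp})\theta_H)M_H,\,T}\bigl(\{x_a,y_a\}_{a\in R}\bigr) = \frac{1}{|C\theta_H|}\,\mathrm{CJ}^{H}_{C\theta_H,T}\Bigl(\Bigl\{\sum_{b\in R}\chi(ab)x_b\Bigr\}_{a\in R},\Bigl\{\sum_{b\in R}\chi(ab)y_b\Bigr\}_{a\in R}\Bigr),$$ where $M_H$ is the $H$-orbit length matrix.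
   Context: A finite (associative, unital) ring $R$ is Frobenius if $R/\mathrm{Rad}(R)\cong \mathrm{Soc}(R_R)$ as right $R$-modules and $R/\mathrm{Rad}(R)\cong\mathrm{Soc}({}_RR)$ as left $R$-modules. $R$ need not be commutative. Let $\widehat R$ be the group of homomorphisms from the additive group of $R$ to $\mathbb{C}^{*}$. A generating character of $R$ is a $\chi\in\widehat R$ that is right generating ($r\mapsto\chi^r$, $\chi^r(x)=\chi(rx)$, is an isomorphism of right $R$-modules $R\to\widehat R$) or left generating ($r\mapsto{}^r\chi$, ${}^r\chi(x)=\chi(xr)$, is an isomorphism of left $R$-modules $R\to\widehat R$); a finite ring is Frobenius if and only if it admits one. On $V=R^n$ put $(u,v):=u_1v_1+\cdots+u_nv_n$. A permutation group $G$ on $\{1,\dots,n\}$ acts on $V$ on the right by $(vg)_i = v_{ig^{-1}}$. A left $G$-code is a left $R$-submodule $C$ of $V$ with $Cg\subseteq C$ for all $g\in G$; its right dual is $C^{\perp}:=\{u\in V:(v,u)=0\text{ for all }v\in C\}$. ''$|H|$ has an inverse in $R$'' means $|H|\cdot 1_R$ is a unit. Define $v\theta_H:=\frac1{|H|}\sum_{h\in H}vh$ for $v\in V$ and $X\theta_H:=\{v\theta_H:v\in X\}$. Let $H_V(\alpha_1),\dots,H_V(\alpha_t)$ be the orbits of $H$ on $\{1,\dots,n\}$, $m_i$ the cardinality of $H_V(\alpha_i)$, and $\overline{H_V(\alpha_i)}\in V$ the vector with entry $1$ at the positions in $H_V(\alpha_i)$ and $0$ elsewhere. Every $u\in V\theta_H$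 is uniquely $u=\sum_{i=1}^t u_i\overline{H_V(\alpha_i)}$ with $u_i\in R$. The $H$-orbit length matrix is $M_H:=\mathrm{diag}(\ell_1,\dots,\ell_n)$ with $\ell_j=m_i$ if $j\in H_V(\alpha_i)$; $YM_H:=\{yM_H:y\in Y\}$ for $Y\subseteq V$. For a left or right $R$-submodule $D\subseteq V\theta_H$ and $T\subseteq E=\{1,\dots,t\}$, the complete $H$-Jacobi polynomial is $\mathrm{CJ}^H_{D,T}(\{x_a,y_a\}_{a\in R}):=\sum_{u\in D}\prod_{a\in R}x_a^{n^H_{a,T}(u)}\,y_a^{n^H_{a,E\setminus T}(u)}$, where $n^H_{a,X}(u)$ is the number of $i\in X$ with $u_i=a$. *)

(* Defs.v *)
From HB Require Import structures.
From mathcomp Require Import all_boot all_order all_fingroup all_algebra.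
From mathcomp Require Import reals.
From mathcomp.real_closed Require Import complex.
From mathcomp Require Import mpoly.

Set Implicit Arguments.
Unset Strict Implicit.
Unset Printing Implicit Defensive.

Import GRing.Theory Num.Theory.
Local Open Scope ring_scope.

(* A module over R, left or right, is given by a carrier type, the predicate
   cutting out its elements, its addition, and the map act : R -> M -> M; for a
   right module, [act r m] stands for m r. *)
Definition module_iso (R M N : Type)
    (inM : {pred M}) (addM : M -> M -> M) (actM : R -> M -> M)
    (inN : {pred N}) (addN : N -> N -> N) (actN : R -> N -> N)
    (f : M -> N) : Prop :=
  [/\ {in inM, forall x, f x \in inN},
      {in inM &, forall x y, f (addM x y) = addN (f x) (f y)},
      {in inM, forall x r, f (actM r x) = actN r (f x)},
      {in inM &, injective f}
    & {in inN, forall y, exists2 x, x \in inM & f x = y}].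

Section Frobenius.
Variable R : finNzRingType.

Definition lmul_act (r x : R) : R := r * x.
Definition rmul_act (r x : R) : R := x * r.

Definition sumset (A B : {set R}) : {set R} := [set a + b | a in A, b in B].

(* Below, [act] is [lmul_act] or [rmul_act], and the notions are
   those for left, respectively right, ideals of R. *)
Section Side.
Variable act : R -> R -> R.

(* Closure under opposites follows, as -1 belongs to R. *)
Definition ideal (I : {set R}) : bool :=
  [&& 0 \in I,
      [forall x in I, forall y in I, x + y \in I]
    & [forall x in I, forall r, act r x \in I]].

Definition maximal_ideal : pred {set R} :=
  maxset (fun I => ideal I && (I != [set: R])).

Definition minimal_ideal : pred {set R} :=
  minset (fun I => ideal I && (I != [set 0])).

Definition socle : {set R} := \big[sumset/[set 0]]_(I | minimal_ideal I) I.

Definition quotient_mod (I : {set R}) : {set {set R}} :=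
  [set [set x + y | y in I] | x : R].

Definition quotient_act (I : {set R}) (r : R) (A : {set R}) : {set R} :=
  sumset [set act r a | a in A] I.

End Side.

(* The Jacobson radical; maximal right ideals have the same intersection. *)
Definition radical : {set R} := \bigcap_(I | maximal_ideal lmul_act I) I.

Definition frobenius : Prop :=
  (exists f : {set R} -> R,
     module_iso (mem (quotient_mod radical)) sumset (quotient_act rmul_act radical)
                (mem (socle rmul_act)) +%R rmul_act f)
  /\
  (exists f : {set R} -> R,
     module_iso (mem (quotient_mod radical)) sumset (quotient_act lmul_act radical)
                (mem (socle lmul_act)) +%R lmul_act f).

End Frobenius.

Section Characters.
Variables (R : finNzRingType) (F : fieldType).
Implicit Type chi : {ffun R -> F}.

(* The elements of the character group: additive-to-multiplicative
   homomorphisms with values in F^*. *)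
Definition charhat : pred {ffun R -> F} :=
  fun chi => [forall x, chi x != 0] &&
             [forall x, forall y, chi (x + y) == chi x * chi y].

Definition char_mul chi psi : {ffun R -> F} := [ffun x => chi x * psi x].

(* chi^r and ^r chi; these are also the right and left actions of R on the
   character group. *)
Definition char_ract (r : R) chi : {ffun R -> F} := [ffun x => chi (r * x)].
Definition char_lact (r : R) chi : {ffun R -> F} := [ffun x => chi (x * r)].

Definition right_generating chi : Prop :=
  module_iso predT +%R (@rmul_act R) charhat char_mul char_ract
             (fun r => char_ract r chi).

Definition left_generating chi : Prop :=
  module_iso predT +%R (@lmul_act R) charhat char_mul char_lact
             (fun r => char_lact r chi).

Definition generating_character chi : Prop :=
  chi \in charhat /\ (right_generating chi \/ left_generating chi).

End Characters.

Section Codes.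
Variables (R : finUnitRingType) (n : nat).
Implicit Types (u v : 'rV[R]_n) (g : 'S_n) (G H : {group 'S_n}).
Implicit Types (C D : {set 'rV[R]_n}).

Definition dotv u v : R := \sum_(i < n) u 0 i * v 0 i.

Definition permv v g : 'rV[R]_n := \row_i v 0 (g^-1%g i).

(* 'rV[R]_n is a left R-module under *: *)
Definition left_Gcode G C : Prop :=
  submod_closed C /\ {in C & G, forall v g, permv v g \in C}.

Definition right_dual C : {set 'rV[R]_n} :=
  [set u | [forall v in C, dotv v u == 0]].

Definition theta H v : 'rV[R]_n := (#|H|%:R)^-1 *: \sum_(h in H) permv v h.

Definition theta_set H C : {set 'rV[R]_n} := [set theta H v | v in C].

Definition orbit_length_mx H : 'M[R]_n :=
  diag_mx (\row_j (#|orbit 'P H j|)%:R).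

Definition mulM_set H C : {set 'rV[R]_n} :=
  [set y *m orbit_length_mx H | y in C].

Section Jacobi.
Variables (t : nat) (H : {group 'S_n}) (alpha : 'I_t -> 'I_n).

(* The orbits of alpha_1, ..., alpha_t enumerate the orbits of H without
   repetition. *)
Definition orbit_representatives : Prop :=
  injective (fun i => orbit 'P H (alpha i)) /\
  [set orbit 'P H (alpha i) | i : 'I_t] = [set orbit 'P H j | j : 'I_n].

Definition orbit_vec (i : 'I_t) : 'rV[R]_n :=
  \row_j (j \in orbit 'P H (alpha i))%:R.

(* The coefficients (u_i) with u = \sum_i u_i (orbit_vec i); they exist and are
   unique for u fixed by H, and [orbit_coord u] is 0 by default otherwise. *)
Definition orbit_coord u : {ffun 'I_t -> R} :=
  odflt 0 [pick c : {ffun 'I_t -> R} | u == \sum_i c i *: orbit_vec i].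

Definition orbit_count (a : R) (X : {set 'I_t}) u : nat :=
  #|[set i in X | orbit_coord u i == a]|.

(* The complete H-Jacobi polynomial of D with arguments (x_a, y_a) in S. *)
Definition CJ (S : comNzRingType) D (T : {set 'I_t}) (x y : R -> S) : S :=
  \sum_(u in D) \prod_(a : R)
     (x a ^+ orbit_count a T u * y a ^+ orbit_count a (~: T) u).

End Jacobi.
End Codes.

Section Indeterminates.
Variables (R : finNzRingType) (F : fieldType).

(* The polynomial ring over F in the 2 |R| variables x_a, y_a (a in R). *)
Definition polyXY := {mpoly F[#|R| + #|R|]}.
Definition varX (a : R) : polyXY := 'X_(lshift #|R| (enum_rank a)).
Definition varY (a : R) : polyXY := 'X_(rshift #|R| (enum_rank a)).

End Indeterminates.
Arguments varX {R} F a.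
Arguments varY {R} F a.

(* Main.v *)
(** Averaging over H projects V onto the H-fixed vectors and is self-adjoint for
    the dot product, so on fixed vectors orthogonality to C is orthogonality to
    C theta_H.  In orbit coordinates the dot product of fixed vectors is
    \sum_i m_i v_i u_i; the m_i divide |H|, hence are central units, and
    multiplying by M_H absorbs them: ((C^perp) theta_H) M_H becomes the ordinary
    dual of C theta_H in R^t.  What remains is the MacWilliams identity over R^t,
    which follows from orthogonality of characters because the kernel of a
    generating character contains no nonzero left ideal. *)
Require Import Defs.
From HB Require Import structures.
From mathcomp Require Import all_boot all_order all_fingroup all_algebra.
From mathcomp Require Import reals.
From mathcomp.real_closed Require Import complex.
From mathcomp Require Import mpoly.

Set Implicit Arguments.
Unset Strict Implicit.
Unset Printing Implicit Defensive.

Import GRing.Theory Num.Theory.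
Local Open Scope ring_scope.

(* Stated for a cancellative operation because {ffun I -> R} has no canonical
   finZmodType structure. *)
Lemma sum_char_eq0 (U : finType) (op : U -> U -> U) (F : fieldType)
    (D : {set U}) (psi : U -> F) (v0 : U) :
  {in D &, forall v w, op v w \in D} -> injective (op v0) ->
  {morph psi : v w / op v w >-> v * w} ->
  v0 \in D -> psi v0 != 1 -> \sum_(v in D) psi v = 0.
Proof.
move=> Dop op_inj psiM v0D psi0; set s := \sum_(_ in _) _.
(* Translation by [v0] permutes [D], so multiplying the sum by [psi v0] leaves it unchanged. *)
have eqD : [set op v0 v | v in D] = D.
  apply/eqP; rewrite eqEcard card_imset // leqnn andbT.
  by apply/subsetP=> _ /imsetP[v vD ->]; exact: Dop.
have: psi v0 * s = s.
  rewrite {2}/s -eqD big_imset /=; last by move=> ? ? _ _; apply: op_inj.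
  by rewrite mulr_sumr; apply: eq_bigr=> v _; rewrite psiM.
move/eqP; rewrite -subr_eq0 -{2}[s]mul1r -mulrBl mulf_eq0 subr_eq0.
by rewrite (negPf psi0) => /eqP.
Qed.

(** * Nondegeneracy of generating characters *)

Section GeneratingCharacter.
Variables (R : finNzRingType) (F : numFieldType) (chi : {ffun R -> F}).
Hypothesis chi_char : chi \in @charhat R F.

Lemma charhatD x y : chi (x + y) = chi x * chi y.
Proof. by case/andP: chi_char => _ /forallP/(_ x)/forallP/(_ y)/eqP. Qed.

Lemma charhat0 : chi 0 = 1.
Proof.
case/andP: chi_char => /forallP/(_ 0) nz0 _.
by apply: (mulfI nz0); rewrite -charhatD addr0 mulr1.
Qed.

(* A double count of the sum of beta over R x R transfers nondegeneracy from
   the left argument to the right one. *)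
Lemma bichar_nondegenerate (beta : R -> R -> F) :
  (forall x, {morph beta^~ x : r s / r + s >-> r * s}) ->
  (forall r, {morph beta r : x y / x + y >-> x * y}) ->
  (forall x, beta 0 x = 1) -> (forall r, beta r 0 = 1) ->
  (forall r, (forall x, beta r x = 1) -> r = 0) ->
  forall x, (forall r, beta r x = 1) -> x = 0.
Proof.
move=> betaDl betaDr beta0l beta0r nondeg.
pose X := [set x | [forall r, beta r x == 1]].
have sumR (psi : R -> F) : {morph psi : x y / x + y >-> x * y} ->
    \sum_x psi x = if [forall x, psi x == 1] then #|R|%:R else 0.
  move=> psiD; case: ifPn => [/forallP psi1 | ].
    by rewrite (eq_bigr (fun=> 1)) ?sumr_const // => x _; apply/eqP.
  rewrite negb_forall => /existsP[x0 nx0].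
  rewrite -[RHS](@sum_char_eq0 _ +%R _ [set: R] psi x0) ?inE //.
    by apply: eq_bigl => x; rewrite inE.
  exact: addrI.
have cardR : #|R|%:R != 0 :> F.
  by rewrite pnatr_eq0 -lt0n; apply/card_gt0P; exists 0.
(* Summing over x first, only r = 0 contributes. Summing over r first, each x in the right kernel
   [X] contributes #|R|. Characteristic zero then gives #|X| = 1. *)
have sum_l : \sum_r \sum_x beta r x = #|R|%:R.
  rewrite (bigD1 0) //= [X in _ + X]big1 => [|r nz_r].
    by rewrite addr0 (eq_bigr (fun=> 1)) ?sumr_const // => x _.
  rewrite sumR //; case: ifP => // /forallP b1; case/negP: nz_r.
  by apply/eqP/nondeg => x; apply/eqP.
have sum_r : \sum_r \sum_x beta r x = #|R|%:R *+ #|X|.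
  rewrite exchange_big /= -sumr_const [RHS]big_mkcond /=.
  by apply: eq_bigr => x _; rewrite sumR // inE.
have X1 : #|X| = 1%N.
  apply/eqP; rewrite -(@eqr_nat F) -(inj_eq (mulfI cardR)) mulr1.
  by rewrite mulr_natr -sum_r sum_l.
have X0 : 0 \in X by rewrite inE; apply/forallP => r; rewrite beta0r.
move=> x bx1; have /eqP/cards1P[z defX] := X1.
have xX : x \in X by rewrite inE; apply/forallP => r; rewrite bx1.
by move: X0 xX; rewrite defX !inE => /eqP-> /eqP->.
Qed.

(** For a left generating character this is injectivity of r |-> [char_lact r chi]. A right
    generating one gives only the mirrored statement, which the bicharacter (r, x) |-> chi (r * x)
    carries to the other side. *)
Lemma generating_nondegenerate : generating_character chi ->
  forall x, (forall r, chi (r * x) = 1) -> x = 0.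
Proof.
case=> _ [] [_ _ _ inj _]; last first.
  move=> x x1; apply: inj; rewrite ?inE //.
  by apply/ffunP => r; rewrite !ffunE x1 mulr0 charhat0.
apply: bichar_nondegenerate => [x r s|r x y|x|r|r r1].
- by rewrite mulrDl charhatD.
- by rewrite mulrDr charhatD.
- by rewrite mul0r charhat0.
- by rewrite mulr0 charhat0.
apply: inj; rewrite ?inE //.
by apply/ffunP => x; rewrite !ffunE r1 mul0r charhat0.
Qed.

End GeneratingCharacter.

(** * The MacWilliams identity for left submodules of R^I *)

Section MacWilliams.
Variables (R : finNzRingType) (F : numFieldType) (chi : {ffun R -> F}).
Variables (I : finType) (D : {set {ffun I -> R}}).
Hypothesis chi_gen : generating_character chi.
Hypothesis DD : {in D &, forall c d : {ffun _ -> _}, c + d \in D}.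
Hypothesis DZ : {in D, forall (c : {ffun _ -> _}) r, [ffun i => r * c i] \in D}.

Definition ffdot (c d : {ffun I -> R}) : R := \sum_i c i * d i.

Definition ffdual : {set {ffun I -> R}} :=
  [set d | [forall c in D, ffdot c d == 0]].

Lemma sum_chi_ffdot d :
  \sum_(c in D) chi (ffdot c d) = if d \in ffdual then #|D|%:R else 0.
Proof.
have [chi_char _] := chi_gen.
have dotD c c' : ffdot (c + c') d = ffdot c d + ffdot c' d.
  by rewrite -big_split; apply: eq_bigr => i _; rewrite ffunE mulrDl.
rewrite inE; case: ifPn => [/forall_inP dD | ].
  rewrite (eq_bigr (fun=> 1)) ?sumr_const // => c cD.
  by rewrite (eqP (dD _ cD)) charhat0.
rewrite negb_forall_in => /exists_inP[c cD nz_cd].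
(* The left ideal generated by the nonzero [ffdot c d] leaves the kernel of [chi]; [D] is closed
   under left scaling, so the summand is a nontrivial character of [D]. *)
have [r nr] : exists r, chi (r * ffdot c d) != 1.
  apply/existsP; apply: contraNT nz_cd; rewrite negb_exists => /forallP ch1.
  apply/eqP/(generating_nondegenerate chi_char chi_gen) => r.
  by move/negPn/eqP: (ch1 r).
pose rc : {ffun I -> R} := [ffun i => r * c i].
apply: (@sum_char_eq0 {ffun I -> R} +%R F D _ rc) => //.
- exact: addrI.
- by move=> c1 c2 /=; rewrite dotD charhatD.
- exact: DZ.
congr (chi _ != 1): nr; rewrite mulr_sumr.
by apply: eq_bigr => i _; rewrite ffunE mulrA.
Qed.

(** Letting [f] depend on the coordinate allows different variables inside and outside [T]. Expand
    the product, exchange the sums and apply orthogonality. *)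
Lemma MacWilliams (A : comAlgType F) (f : I -> R -> A) :
  \sum_(c in D) \prod_i (\sum_b chi (c i * b) *: f i b) =
  #|D|%:R *: \sum_(d in ffdual) \prod_i f i (d i).
Proof.
have [chi_char _] := chi_gen.
under eq_bigr => c _.
  rewrite bigA_distr_bigA /=.
  under eq_bigr => d _.
    rewrite scaler_prod.
    have -> : \prod_i chi (c i * d i) = chi (ffdot c d).
      rewrite /ffdot (big_morph chi (charhatD chi_char) (charhat0 chi_char)).
      by [].
    over.
  over.
rewrite exchange_big scaler_sumr [RHS]big_mkcond /=; apply: eq_bigr => d _.
by rewrite -scaler_suml sum_chi_ffdot; case: ifP; rewrite ?scale0r.
Qed.

End MacWilliams.

(** * The averaging projection and its adjoint *)

Section Averaging.
Variables (R : finUnitRingType) (n : nat).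
Implicit Types (u v : 'rV[R]_n) (g : 'S_n) (G H : {group 'S_n}).
Implicit Types (C : {set 'rV[R]_n}).

Lemma theta_fixed H v g : g \in H -> permv (theta H v) g = theta H v.
Proof.
move=> gH; apply/rowP => j; rewrite !mxE !summxE; congr (_ * _).
rewrite [RHS](reindex_inj (mulIg g)) /=; apply: eq_big => [h|h _].
  by rewrite groupMr.
by rewrite !mxE invMg permM.
Qed.

Lemma theta_id H v : (#|H|%:R : R) \is a GRing.unit ->
  {in H, forall h, permv v h = v} -> theta H v = v.
Proof.
move=> uH vH; rewrite /theta (eq_bigr (fun=> v)) // sumr_const.
by rewrite -scaler_nat scalerA mulVr // scale1r.
Qed.

Lemma theta_in G H C v : H \subset G -> left_Gcode G C -> v \in C ->
  theta H v \in C.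
Proof.
move=> /subsetP sHG [[C0 CP] CG] vC; rewrite -[theta H v]addr0; apply: (CP) => //.
apply: (big_ind (fun w => w \in C)) => // [x y xC yC|h hH].
  by rewrite -[x]scale1r CP.
by apply: CG => //; apply: sHG.
Qed.

Lemma dotv_permv u v g : dotv v (permv u g) = dotv (permv v g^-1%g) u.
Proof.
rewrite /dotv (reindex_inj (@perm_inj _ g)); apply: eq_bigr => i _.
by rewrite !mxE invgK permK.
Qed.

Lemma dotv_theta H u v : dotv v (theta H u) = dotv (theta H v) u.
Proof.
pose k : R := #|H|%:R^-1.
(* [R] may be noncommutative, but [k] is central, so it can move past the entries of [v]. *)
have kC x : k * x = x * k by apply/esym/commrV/commr_nat.
have -> : dotv v (theta H u) = k * \sum_(h in H) dotv v (permv u h).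
  rewrite exchange_big mulr_sumr /=; apply: eq_bigr => i _.
  by rewrite !mxE summxE -mulr_sumr !mulrA; congr (_ * _); rewrite kC.
have -> : dotv (theta H v) u = k * \sum_(h in H) dotv (permv v h) u.
  rewrite exchange_big mulr_sumr /=; apply: eq_bigr => i _.
  by rewrite !mxE summxE -mulr_suml mulrA.
congr (_ * _); rewrite [RHS](reindex_inj invg_inj) /=.
by apply: eq_big => h; rewrite ?groupV // => _; rewrite dotv_permv.
Qed.

(** By orbit-stabilizer the orbit length divides #|H|, and commuting factors of a unit are units. *)
Lemma orbit_card_unit H j : (#|H|%:R : R) \is a GRing.unit ->
  (#|orbit 'P H j|%:R : R) \is a GRing.unit.
Proof.
rewrite -(card_orbit_stab 'P H j) natrM unitrM_comm; last exact: commr_nat.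
by case/andP.
Qed.

End Averaging.

(** * Orbit coordinates on the H-fixed vectors *)

Section OrbitCoordinates.
Variables (R : finUnitRingType) (n t : nat) (H : {group 'S_n}).
Variable alpha : 'I_t -> 'I_n.
Hypothesis halpha : orbit_representatives H alpha.
Implicit Types (c d : {ffun 'I_t -> R}) (u v : 'rV[R]_n).

Definition orbit_comb c : 'rV[R]_n := \sum_i c i *: orbit_vec R H alpha i.

Lemma orbit_index_exists j : exists i, j \in orbit 'P H (alpha i).
Proof.
have [_ eqO] := halpha.
have /imsetP[i _ eq_ij] : orbit 'P H j \in [set orbit 'P H (alpha i) | i : 'I_t].
  by rewrite eqO imset_f.
by exists i; rewrite -eq_ij orbit_refl.
Qed.

Lemma orbit_index_inj i i' j :
  j \in orbit 'P H (alpha i) -> j \in orbit 'P H (alpha i') -> i = i'.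
Proof.
have [injO _] := halpha => /orbit_eqP ji /orbit_eqP ji'.
by apply: injO; rewrite /= -ji.
Qed.

Lemma orbit_combE c i j : j \in orbit 'P H (alpha i) -> orbit_comb c 0 j = c i.
Proof.
move=> ji; rewrite summxE (bigD1 i) //= !mxE ji mulr1 big1 ?addr0 // => k nki.
rewrite !mxE; have [jk|_] := boolP (j \in _); last by rewrite mulr0.
by case/eqP: nki; apply: orbit_index_inj jk ji.
Qed.

Lemma orbit_comb_alpha c i : orbit_comb c 0 (alpha i) = c i.
Proof. exact/orbit_combE/orbit_refl. Qed.

Lemma orbit_comb_inj : injective orbit_comb.
Proof. by move=> c d eq_cd; apply/ffunP=> i; rewrite -!orbit_comb_alpha eq_cd. Qed.

Lemma orbit_coordK c : orbit_coord H alpha (orbit_comb c) = c.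
Proof.
rewrite /orbit_coord; case: pickP => [d /eqP/orbit_comb_inj <- //|/(_ c)].
by rewrite eqxx.
Qed.

Lemma orbit_combD c d : orbit_comb (c + d) = orbit_comb c + orbit_comb d.
Proof. by rewrite -big_split; apply: eq_bigr => i _; rewrite ffunE scalerDl. Qed.

Lemma orbit_combZ r c : orbit_comb [ffun i => r * c i] = r *: orbit_comb c.
Proof. by rewrite scaler_sumr; apply: eq_bigr => i _; rewrite ffunE scalerA. Qed.

Lemma orbit_comb_fixed c h : h \in H -> permv (orbit_comb c) h = orbit_comb c.
Proof.
move=> hH; apply/rowP => j; rewrite mxE.
have [i ji] := orbit_index_exists j; rewrite (orbit_combE _ ji).
apply: orbit_combE; apply: orbit_trans ji.
by apply/orbitP; exists h^-1%g; rewrite ?groupV.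
Qed.

Lemma fixed_orbit_comb u : {in H, forall h, permv u h = u} ->
  exists c, u = orbit_comb c.
Proof.
(* A fixed vector is constant on orbits, so its coefficients are read off at the representatives. *)
move=> uH; exists [ffun i => u 0 (alpha i)]; apply/rowP => j.
have [i ji] := orbit_index_exists j; rewrite (orbit_combE _ ji) ffunE.
by have /orbitP[h hH <-] := ji; rewrite -{1}(uH h hH) mxE /= /aperm permK.
Qed.

Lemma orbit_comb_mulM c :
  orbit_comb c *m orbit_length_mx R H =
  orbit_comb [ffun i => c i * #|orbit 'P H (alpha i)|%:R].
Proof.
apply/rowP => j; rewrite mul_mx_diag !mxE.
have [i ji] := orbit_index_exists j; rewrite !(orbit_combE _ ji) ffunE.
by have /orbit_eqP-> := ji.
Qed.

(** Each orbit contributes c i * d i once per position. Putting the length on the second argument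
    matches the effect of M_H in [orbit_comb_mulM]. *)
Lemma dotv_orbit_comb c d :
  dotv (orbit_comb c) (orbit_comb d) =
  ffdot c [ffun i => d i * #|orbit 'P H (alpha i)|%:R].
Proof.
pose idx j := xchoose (orbit_index_exists j).
have idxP j : j \in orbit 'P H (alpha (idx j)) := xchooseP (orbit_index_exists j).
rewrite /dotv (partition_big idx predT) //=; apply: eq_bigr => i _.
rewrite ffunE mulr_natr mulrnAr -sumr_const; apply: eq_big => j.
  by apply/eqP/idP => [<- //|ji]; exact: orbit_index_inj (idxP j) ji.
by move/eqP=> <-; rewrite !(orbit_combE _ (idxP j)).
Qed.

(** Grouping the indices i by the value c i turns exponent counts into a product over orbits, the
    form [MacWilliams] takes. *)
Lemma CJ_orbit_comb (S : comNzRingType) (D : {set {ffun 'I_t -> R}}) T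
    (x y : R -> S) :
  CJ H alpha (orbit_comb @: D) T x y =
  \sum_(c in D) \prod_i (if i \in T then x (c i) else y (c i)).
Proof.
rewrite /CJ big_imset /=; last by move=> ? ? _ _; apply: orbit_comb_inj.
apply: eq_bigr => c _; rewrite [RHS](partition_big c predT) //=.
apply: eq_bigr => a _; rewrite (bigID (mem T)) /= /orbit_count orbit_coordK.
congr (_ * _); rewrite -prodr_const; apply: eq_big => i; rewrite ?inE.
- exact: andbC.
- by case/andP=> -> /eqP->.
- exact: andbC.
- by case/andP=> /negPf-> /eqP->.
Qed.

End OrbitCoordinates.

Theorem theorem6p1
  (K : realType) (R : finUnitRingType) (hR : frobenius R)
  (chi : {ffun R -> complex K}) (hchi : generating_character chi)
  (n : nat) (G H : {group 'S_n}) (hHG : H \subset G)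
  (hH : (#|H|%:R : R) \is a GRing.unit)
  (t : nat) (alpha : 'I_t -> 'I_n) (halpha : orbit_representatives H alpha)
  (T : {set 'I_t}) (C : {set 'rV[R]_n}) (hC : left_Gcode G C) :
  CJ H alpha (mulM_set H (theta_set H (right_dual C))) T
     (varX (complex K)) (varY (complex K)) =
  (#|theta_set H C|%:R : complex K)^-1 *:
    CJ H alpha (theta_set H C) T
       (fun a : R => \sum_(b : R) chi (a * b) *: varX (complex K) b)
       (fun a : R => \sum_(b : R) chi (a * b) *: varY (complex K) b).
Proof.
pose phi := @orbit_comb R n t H alpha.
have fixC u : {in H, forall h, permv u h = u} ->
    (u \in theta_set H C) = (u \in C).
  move=> uH; apply/imsetP/idP => [[v vC ->]|uC]; first exact: theta_in hHG hC vC.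
  by exists u; rewrite ?theta_id.
(* [D] is C theta_H in orbit coordinates, since by [fixC] C theta_H consists of the fixed vectors of
   [C]. *)
pose D := [set c | phi c \in C].
have thetaE : theta_set H C = phi @: D.
  apply/setP=> u; apply/idP/imsetP => [uC|[c cD ->]]; last first.
    by rewrite fixC; [rewrite inE in cD | exact: orbit_comb_fixed].
  have uH : {in H, forall h, permv u h = u}.
    by have /imsetP[v _ ->] := uC; exact: theta_fixed.
  have [c def_u] := fixed_orbit_comb halpha uH.
  by exists c => //; rewrite inE /phi -def_u -fixC.
have dualE : mulM_set H (theta_set H (right_dual C)) = phi @: ffdual D.
  apply/setP=> w; apply/imsetP/imsetP => [[_ /imsetP[u uC ->] ->]|[d dD ->]].
    have [e def_e] := fixed_orbit_comb halpha (@theta_fixed _ _ H u).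
    exists [ffun i => e i * #|orbit 'P H (alpha i)|%:R]; last first.
      by rewrite def_e orbit_comb_mulM.
    rewrite inE; apply/forall_inP => c; rewrite inE => cC.
    rewrite -dotv_orbit_comb // -def_e dotv_theta.
    by move: uC; rewrite inE => /forall_inP; apply; exact: theta_in hHG hC cC.
  (* Dividing by the orbit lengths undoes M_H, so [phi e] is the required preimage of [phi d]. *)
  pose e := [ffun i => d i / #|orbit 'P H (alpha i)|%:R].
  have eK : [ffun i => e i * #|orbit 'P H (alpha i)|%:R] = d.
    by apply/ffunP=> i; rewrite !ffunE divrK ?orbit_card_unit.
  have eT : theta H (phi e) = phi e.
    by apply: theta_id => // h; exact: orbit_comb_fixed.
  exists (phi e); last by rewrite orbit_comb_mulM // eK.
  apply/imsetP; exists (phi e) => //; rewrite inE; apply/forall_inP => v vC.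
  have [c def_c] := fixed_orbit_comb halpha (@theta_fixed _ _ H v).
  (* As [phi e] is fixed, self-adjointness replaces the arbitrary codeword [v] by [theta H v], which
     has orbit coordinates in [D]. *)
  rewrite -eT dotv_theta def_c dotv_orbit_comb // eK.
  move: dD; rewrite inE => /forall_inP; apply.
  by rewrite inE /phi -def_c; exact: theta_in hHG hC vC.
have [[C0 CP] _] := hC.
have D0 : 0 \in D.
  by rewrite inE /phi /orbit_comb big1 // => i _; rewrite ffunE scale0r.
have DD : {in D &, forall c d : {ffun _ -> _}, c + d \in D}.
  move=> c d; rewrite !inE => cC dC.
  by rewrite /phi orbit_combD -/(phi c) -[phi c]scale1r CP.
have DZ : {in D, forall (c : {ffun _ -> _}) r, [ffun i => r * c i] \in D}.
  move=> c; rewrite !inE => cC r.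
  by rewrite inE /phi orbit_combZ -[_ *: _]addr0 CP.
rewrite dualE thetaE !CJ_orbit_comb // card_imset; last exact: orbit_comb_inj.
pose f i (b : R) : polyXY R (complex K) :=
  if i \in T then varX (complex K) b else varY (complex K) b.
(* Invertibility of #|D| lets the factor 1/|C theta_H| be cleared. *)
have cardD : #|D|%:R != 0 :> complex K.
  by rewrite pnatr_eq0 -lt0n; apply/card_gt0P; exists 0.
apply: (scalerI cardD); rewrite scalerA mulfV // scale1r.
rewrite -(MacWilliams hchi DD DZ f).
apply: eq_bigr => c _; apply: eq_bigr => i _; rewrite /f.
by case: (i \in T).
Qed.
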